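(* Let $\theta\in\{0,1,\nu\}$ and let $C_\theta$ be a $\beta_\theta$-constacyclic code over $R_\theta$ of arbitrary length $N=n\cdot 2^s$, where $s$ and $n$ are positive integers and $n$ is odd. Let $C_\theta=\langle l_{\theta_1}(z),l_{\theta_2}(z)\rangle$, where $l_{\theta_i}(z)\in R_\theta[z]/\langle z^N-\beta_\theta\rangle$ for $i=1,2$ are of the form $l_{\theta_1}(z)=(z^n-1)^{t_1}+k_\theta h(z)$ and $l_{\theta_2}(z)=k_\theta(z^n-1)^{t_2}$ with $0\le t_1,t_2\le 2^{s+1}$ and $h(z)$ in $Z_4[z]/\langle z^N+1\rangle$. Then $C_\theta$ is a reversible $\beta_\theta$-constacyclic code if and only if $l_{\theta_1}^{*}(z)\in C_\theta$.
   Context: $Z_4$ denotes the ring of integers modulo $4$. For $\theta\in\{0,1,\nu\}$, $R_\theta=Z_4+\nu Z_4$ is the commutative ring of elements $a+b\nu$ ($a,b\in Z_4$) with $\nu^2=\theta$. Put $k_\theta=\nu$ if $\theta\in\{0,\nu\}$ and $k_\theta=1+\nu$ if $\theta=1$. For a unit $\lambda$ of a finite commutative ring $R$ with unity, a $\lambda$-constacyclic code of length $N$ over $R$ is a linear code in $R^N$ closed under $(s_0,\dots,s_{N-1})\mapsto(\lambda s_{N-1},s_0,\dots,s_{N-2})$; equivalently, identifying $(s_0,\dots,s_{N-1})$ with $s_0+s_1z+\cdots+s_{N-1}z^{N-1}$, it is an ideal of $R[z]/\langle z^N-\lambda\rangle$. $\langle\cdots\rangle$ denotes the generated ideal. $\beta_\theta$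 denotes any one of the following units of $R_\theta$: for $\theta=0$: $3,\ 3+2\nu,\ 3+3\nu,\ 3+\nu$; for $\theta=1$: $3,\ \nu,\ 1+2\nu,\ 2+3\nu$; for $\theta=\nu$: $3+2\nu$. Elements of $Z_4[z]/\langle z^N+1\rangle$ are represented by polynomials of degree less than $N$ over $Z_4\subset R_\theta$ when they appear in expressions over $R_\theta$. A code $C$ of length $N$ is reversible if $(s_{N-1},s_{N-2},\dots,s_0)\in C$ for every $(s_0,s_1,\dots,s_{N-1})\in C$. For a polynomial $g(z)$ of degree $t\le N-1$, its reciprocal polynomial is $g^{*}(z)=z^{t}g(z^{-1})$. *)

(* Defs.v *)
From HB Require Import structures.
From mathcomp Require Import all_boot all_order all_algebra.
From mathcomp Require Import ring.

Set Implicit Arguments.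
Unset Strict Implicit.
Unset Printing Implicit Defensive.

Import GRing.Theory.
Local Open Scope ring_scope.

(* The three admissible values 0, 1, nu of theta. They are mere indices here,
   since nu only exists once the ring R_theta has been built. *)
Variant theta := theta0 | theta1 | thetanu.

Definition theta_poly (t : theta) : {poly 'Z_4} :=
  match t with
  | theta0 => 0
  | theta1 => 1
  | thetanu => 'X
  end.

Definition R_poly (t : theta) : {poly 'Z_4} := 'X^2 - theta_poly t.

Notation Rring t := {poly %/ R_poly t}.

Definition nu (t : theta) : Rring t := 'qX.

Definition kk (t : theta) : Rring t :=
  match t with
  | theta1 => 1 + nu t
  | _ => nu t
  end.

Definition betas (t : theta) : seq (Rring t) :=
  match t with
  | theta0 => [:: 3; 3 + 2 * nu t; 3 + 3 * nu t; 3 + nu t]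
  | theta1 => [:: 3; nu t; 1 + 2 * nu t; 2 + 3 * nu t]
  | thetanu => [:: 3 + 2 * nu t]
  end.

(* {poly %/ p} is the quotient by p only for p monic of size > 1; the next
   facts show that this, and nu ^ 2 = theta, hold for the quotients used. *)
Fact size_theta_poly (t : theta) : (size (theta_poly t) < 3)%N.
Proof. by case: t; rewrite ?size_poly0 ?size_poly1 ?size_polyX. Qed.

Fact R_poly_size (t : theta) : size (R_poly t) = 3.
Proof.
by rewrite size_polyDl size_polyXn // size_polyN size_theta_poly.
Qed.

Fact R_poly_monic (t : theta) : R_poly t \is monic.
Proof.
by rewrite monicE lead_coefDl ?lead_coefXn // size_polyN size_polyXn size_theta_poly.
Qed.

Fact nu_sqr (t : theta) : nu t ^+ 2 = in_qpoly (R_poly t) (theta_poly t).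
Proof.
rewrite /nu -rmorphXn /=; apply/eqP; rewrite -subr_eq0 -rmorphB /=.
apply/eqP/val_inj => /=; rewrite /mk_monic R_poly_size R_poly_monic /=.
exact: Pdiv.RingMonic.rmodpp (R_poly_monic t).
Qed.

Fact four_eq0 (t : theta) : 4 = 0 :> Rring t.
Proof.
by rewrite -(rmorph_nat (qpolyC (R_poly t))) (_ : 4 = 0) ?rmorph0 //; apply/val_inj.
Qed.

Fact betas_unit (t : theta) (b : Rring t) :
  b \in betas t -> exists c : Rring t, b * c = 1.
Proof.
pose m := in_qpoly (R_poly t) (theta_poly t).
have key (x a c : Rring t) : x = 1 + 4 * a + c * (nu t ^+ 2 - m) -> x = 1.
  by move=> ->; rewrite four_eq0 nu_sqr subrr mul0r mulr0 !addr0.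
case: t b @m key => b /=.
- rewrite in_qpoly0 => key; rewrite !inE => /or4P[] /eqP ->.
  + by exists 3; apply: (key _ 2 0); ring.
  + by exists (3 + 2 * nu theta0); apply: (key _ (2 + 3 * nu theta0) 4); ring.
  + by exists (3 + nu theta0); apply: (key _ (2 + 3 * nu theta0) 3); ring.
  + by exists (3 + 3 * nu theta0); apply: (key _ (2 + 3 * nu theta0) 3); ring.
- rewrite in_qpoly1 => key; rewrite !inE => /or4P[] /eqP ->.
  + by exists 3; apply: (key _ 2 0); ring.
  + by exists (nu theta1); apply: (key _ 0 1); ring.
  + by exists (1 + 2 * nu theta1); apply: (key _ (1 + nu theta1) 4); ring.
  + by exists (2 + 3 * nu theta1); apply: (key _ (3 + 3 * nu theta1) 9); ring.
- rewrite -/(nu thetanu) => key; rewrite !inE => /eqP ->.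
  by exists (3 + 2 * nu thetanu); apply: (key _ (2 + 4 * nu thetanu) 4); ring.
Qed.

Section Codes.

Variables (R : comNzRingType) (N : nat).

Implicit Types (s : 'rV[R]_N) (C : {pred 'rV[R]_N}) (lambda : R).

(* (s_0, ..., s_(N-1)) |-> (lambda s_(N-1), s_0, ..., s_(N-2)); ord_pred is the
   cyclic predecessor, so it sends 0 to N - 1. *)
Definition constashift lambda s : 'rV[R]_N :=
  \row_(i < N) (if i == 0 :> nat then lambda * s 0 (ord_pred i)
                else s 0 (ord_pred i)).

Definition constacyclic lambda C : Prop :=
  submod_closed C /\ forall s, s \in C -> constashift lambda s \in C.

Definition reversible C : Prop :=
  forall s, s \in C -> \row_(i < N) s 0 (rev_ord i) \in C.

Definition constapoly lambda : {poly R} := 'X^N - lambda%:P.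

Definition generated_by lambda C (l1 l2 : {poly %/ constapoly lambda}) : Prop :=
  forall s, s \in C <->
    exists a b : {poly %/ constapoly lambda},
      in_qpoly (constapoly lambda) (rVpoly s) = a * l1 + b * l2.

Fact constapoly_size lambda : (0 < N)%N -> size (constapoly lambda) = N.+1.
Proof. exact: size_XnsubC. Qed.

Fact constapoly_monic lambda : (0 < N)%N -> constapoly lambda \is monic.
Proof. exact: monicXnsubC. Qed.

(* z ^ t g(1 / z), where t = deg g; it is 0 for g = 0. *)
Definition reciprocal (g : {poly R}) : {poly R} :=
  \poly_(i < size g) g`_((size g).-1 - i).

End Codes.

Arguments constapoly {R} N lambda.
Arguments generated_by {R N} lambda C l1 l2.

(* A polynomial over Z_4, viewed over R_theta. *)
Definition lift_R (t : theta) (p : {poly 'Z_4}) : {poly Rring t} :=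
  map_poly (qpolyC (R_poly t)) p.

(* Main.v *)
Require Import Defs.
From mathcomp Require Import all_boot all_order all_algebra.
From mathcomp Require Import ring zify.

Set Implicit Arguments.
Unset Strict Implicit.
Unset Printing Implicit Defensive.

Import GRing.Theory.
Local Open Scope ring_scope.

(** Write Q = R[z]/(z^N - b) and let rev be the reversal of codewords seen on
    Q. Morally rev f = z^(N-1) f(1/z), but the substitution of 1/z for z is only
    well defined on Q when b^2 = 1. In general the defect is explicit:
      z rev (z f) = rev f + (b^2 - 1) f_(N-1)      ([mul_rev_mulX]).
    Hence, if an ideal I contains the defects (b^2 - 1) f_(N-1) of all its
    elements f, then I is stable under rev as soon as rev maps its generators
    into I ([ideal_rev_closed]). The words rev g and g^* differ by a
    power of the unit z ([mulXn_reciprocal]), so rev l1 may be replaced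
    by l1^*.

    Since k (b^2 - 1) = 0, reversal has no defect on multiples of k, and there
    it sends k (z^n - 1)^t to a multiple of k (z^n - 1)^t ([rev_kuX]); so the
    generator l2 never imposes a condition.

    It remains to see that I contains its defects ([defect_in_ideal]). This is
    trivial when b^2 = 1. The only other units in question are 3 + 3 nu and 3 + nu for
    theta = 0, and there k^2 = 0, k b = - k and b^2 - 1 = 2 k ([betas_cases]).
    Put u = z^n - 1. Modulo 4, u^(2^s) = z^N + 1 + 2 z^(N/2), and
    k z^N = - k, whence k u^(2^s) = 2 k z^(N/2) ([k_upow2]). If t1 < 2^s, then
    k u^(2^s - t1) l1 = k u^(2^s), so 2 k itself lies in I. If t1 >= 2^s, then
    2 k kills both generators, and all the defects are 0. *)

(** * Reversal in constacyclic quotients *)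

Section Reversal.

Variables (R : comNzRingType) (N : nat) (b c : R).
Hypotheses (N_gt0 : (0 < N)%N) (bc : b * c = 1).

Local Notation P := (constapoly N b).
Local Notation Q := {poly %/ P}.
Local Notation z := ('qX : Q).

Implicit Types (f g a : Q).

Lemma mk_monic_constapoly : mk_monic P = P.
Proof. by rewrite /mk_monic constapoly_size // constapoly_monic // ltnS N_gt0. Qed.

Lemma size_constaq f : (size (f : {poly R}) <= N)%N.
Proof.
rewrite -ltnS -(constapoly_size b N_gt0) -{2}mk_monic_constapoly.
exact: size_mk_monic.
Qed.

Lemma in_constaq_small (p : {poly R}) :
  (size p <= N)%N -> in_qpoly P p = p :> {poly R}.
Proof.
by move=> sp; rewrite in_qpoly_small // mk_monic_constapoly constapoly_size.
Qed.

Lemma in_constaqK f : in_qpoly P f = f.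
Proof. by apply/val_inj/in_constaq_small/size_constaq. Qed.

Lemma in_constaq_eq0 : in_qpoly P P = 0.
Proof.
apply: val_inj; rewrite /= mk_monic_constapoly.
exact: Pdiv.RingMonic.rmodpp (constapoly_monic _ N_gt0).
Qed.

Lemma in_constaqC (r : R) : in_qpoly P r%:P = r *: 1.
Proof. by rewrite -alg_polyC linearZ /= rmorph1. Qed.

Lemma constaqX_N : z ^+ N = b *: 1.
Proof.
apply/eqP; rewrite -subr_eq0 -in_constaqC -rmorphXn -rmorphB /=.
by rewrite in_constaq_eq0.
Qed.

Lemma constaqX_inv (m : nat) : exists y, y * z ^+ m = 1.
Proof.
exists ((c *: z ^+ N.-1) ^+ m); rewrite -exprMn -scalerAl -exprSr prednK //.
by rewrite constaqX_N scalerA mulrC bc scale1r expr1n.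
Qed.

Definition rev f : Q := in_qpoly P (\poly_(i < N) f`_(N - i.+1)).

Lemma revD f g : rev (f + g) = rev f + rev g.
Proof.
rewrite /rev -rmorphD /=; congr in_qpoly; apply/polyP=> i.
by rewrite coefD !coef_poly; case: ifP => _; rewrite ?addr0 ?coefD.
Qed.

Lemma revZ (r : R) f : rev (r *: f) = r *: rev f.
Proof.
rewrite /rev -linearZ /=; congr in_qpoly; apply/polyP=> i.
by rewrite coefZ !coef_poly; case: ifP => _; rewrite ?mulr0 ?coefZ.
Qed.

Lemma polyq_mulX f : z * f = 'X * f - f`_N.-1 *: P :> {poly R}.
Proof.
have -> : z * f = in_qpoly P ('X * f - f`_N.-1 *: P).
  by rewrite rmorphB rmorphM /= linearZ /= in_constaq_eq0 scaler0 subr0 in_constaqK.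
apply: in_constaq_small; apply/leq_sizeP => i lti.
rewrite coefB coefXM coefZ coefB coefXn coefC.
case: i lti => [|i] lti; first by move: N_gt0; rewrite ltnNge lti.
rewrite /= subr0; case: eqP => [iN|ne].
  have <- : N.-1 = i by move: iN; lia.
  by rewrite mulr1 subrr.
by rewrite mulr0 subr0 nth_default // (leq_trans (size_constaq f)) //; lia.
Qed.

(** The coefficient wrapped around by z is multiplied by b before the reversal
    and again after it, instead of cancelling; hence the factor b^2 - 1. *)
Lemma mul_rev_mulX f : z * rev (z * f) = rev f + ((b ^+ 2 - 1) * f`_N.-1) *: 1.
Proof.
have := polyq_mulX f; move: (z * f) => g gE.
have -> : ((b ^+ 2 - 1) * f`_N.-1) *: (1 : Q)
          = in_qpoly P ((b * f`_N.-1) *: 'X^N - f`_N.-1 *: 1).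
  rewrite linearB linearZ /= linearZ /= rmorph1 rmorphXn /= constaqX_N.
  by rewrite scalerA -scalerBl; congr (_ *: _); ring.
rewrite -rmorphM -linearD /=; congr in_qpoly; apply/polyP=> i.
rewrite coefXM coefD coefB !coefZ coefXn coef1 !coef_poly gE.
case: i => [|i] /=.
  by rewrite subn1 N_gt0 eq_sym eqn0Ngt N_gt0 mulr0 mulr1 sub0r subrr.
rewrite mulr0 subr0 coefB coefXM coefZ coefB coefXn coefC.
case: (ltngtP i.+1 N) => iN.
- have -> : (N - i.+1 == 0)%N = false by lia.
  have -> : (N - i.+1 == N)%N = false by lia.
  rewrite subr0 !mulr0 subr0 addr0; congr (_`__); lia.
- by rewrite mulr0 addr0.
have -> : (N - i.+1 = 0)%N by lia.
have -> : (0 == N)%N = false by lia.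
by rewrite /= mulr1 !add0r mulrN opprK mulrC.
Qed.

Lemma polyXn_mul_reciprocal (p : {poly R}) : (size p <= N)%N ->
  'X^(N - size p) * reciprocal p = \poly_(i < N) p`_(N - i.+1).
Proof.
have p0 j : (size p <= j)%N -> p`_j = 0 by exact: nth_default.
move=> spN; apply/polyP=> i; rewrite coefXnM !coef_poly.
move: (size p) spN p0 => m leN p0.
case: (ltnP i (N - m)) => im; case: (ltnP i N) => iN //.
- by rewrite p0 //; lia.
- have -> : (i - (N - m) < m)%N by lia.
  by congr (_`__); lia.
- by have -> : (i - (N - m) < m)%N = false by lia.
Qed.

(** The reversal of a word of length N is z^(N - 1 - deg f) f^*, and z is a unit:
    an ideal cannot tell them apart. For f = 0 both sides vanish. *)
Lemma mulXn_reciprocal f :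
  z ^+ (N - size (f : {poly R})) * in_qpoly P (reciprocal f) = rev f.
Proof.
by rewrite -rmorphXn -rmorphM /= polyXn_mul_reciprocal ?size_constaq.
Qed.

Lemma in_qpoly_rVpoly_rev (v : 'rV[R]_N) :
  in_qpoly P (rVpoly (\row_(i < N) v 0 (rev_ord i))) = rev (in_qpoly P (rVpoly v)).
Proof.
rewrite {1}/rev; congr in_qpoly; apply/polyP=> i.
rewrite [RHS]coef_poly in_constaq_small ?size_poly //.
have [ltiN|leNi] := ltnP i N; last first.
  by rewrite nth_default // (leq_trans _ leNi) ?size_poly.
rewrite (coef_rVpoly_ord _ (Ordinal ltiN)) mxE.
by rewrite -(coef_rVpoly_ord v (rev_ord (Ordinal ltiN))).
Qed.

(** * Ideals with two generators *)

Section Ideal.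

Variables l1 l2 : Q.

Definition ideal2 f : Prop := exists a d, f = a * l1 + d * l2.

Lemma ideal2_l1 : ideal2 l1.
Proof. by exists 1, 0; rewrite mul1r mul0r addr0. Qed.

Lemma ideal2_l2 : ideal2 l2.
Proof. by exists 0, 1; rewrite mul1r mul0r add0r. Qed.

Lemma ideal2M a f : ideal2 f -> ideal2 (a * f).
Proof. by case=> x [y ->]; exists (a * x), (a * y); rewrite mulrDr !mulrA. Qed.

Lemma ideal2D f g : ideal2 f -> ideal2 g -> ideal2 (f + g).
Proof.
by case=> x [y ->] [x' [y' ->]]; exists (x + x'), (y + y'); ring.
Qed.

Lemma ideal2Z (r : R) f : ideal2 f -> ideal2 (r *: f).
Proof.
by move=> If; rewrite -[f in r *: f]mul1r scalerAl; apply: ideal2M.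
Qed.

Lemma ideal2_XnM (m : nat) f : ideal2 (z ^+ m * f) <-> ideal2 f.
Proof.
split; last exact: ideal2M.
have [y yz] := constaqX_inv m.
by move=> /(ideal2M y); rewrite mulrA yz mul1r.
Qed.

(** Closure is proved by Horner's scheme on the multiplier a: multiplication by z
    moves rev by a unit, up to a defect that lies in the ideal. *)
Lemma rev_mul_in_ideal g :
  (forall f, ideal2 f -> ideal2 (((b ^+ 2 - 1) * f`_N.-1) *: 1)) ->
  ideal2 g -> ideal2 (rev g) -> forall a, ideal2 (rev (a * g)).
Proof.
move=> defect Ig Irg a; rewrite -[a]in_constaqK.
elim/poly_ind: (a : {poly R}) => [|p r IHp].
  by rewrite rmorph0 mul0r -(scale0r g) revZ; apply: ideal2Z.
rewrite rmorphD rmorphM /= in_constaqC mulrDl -scalerAl mul1r revD revZ.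
apply: ideal2D; last exact: ideal2Z.
rewrite [_ * z]mulrC -mulrA; apply/(ideal2_XnM 1); rewrite mul_rev_mulX.
by apply: ideal2D => //; apply/defect/ideal2M.
Qed.

Lemma ideal_rev_closed :
  (forall f, ideal2 f -> ideal2 (((b ^+ 2 - 1) * f`_N.-1) *: 1)) ->
  ideal2 (rev l1) -> ideal2 (rev l2) -> forall f, ideal2 f -> ideal2 (rev f).
Proof.
move=> defect Ir1 Ir2 _ [a [d ->]]; rewrite revD.
by apply: ideal2D; apply: rev_mul_in_ideal => //;
  [apply: ideal2_l1 | apply: ideal2_l2].
Qed.

End Ideal.

(** * Reversal of multiples of k *)

Section DefectFree.

Variables (k : R) (n : nat).
Hypothesis kdefect : k * (b ^+ 2 - 1) = 0.

(** The defect of a multiple of k is a multiple of k (b^2 - 1) = 0, so there rev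
    does exchange multiplication by z and by 1/z. *)
Lemma mul_rev_kX f (m : nat) : z ^+ m * rev (z ^+ m * (k *: f)) = rev (k *: f).
Proof.
have kd x : (b ^+ 2 - 1) * (k * x) = 0.
  by rewrite mulrA [_ * k]mulrC kdefect mul0r.
elim: m => [|m IHm]; first by rewrite !mul1r.
rewrite {1}exprSr -mulrA exprS -mulrA -scalerAr mul_rev_mulX coefZ.
by rewrite kd scale0r addr0 scalerAr.
Qed.

(** Under 1/z for z, z^n - 1 becomes - z^(-n) (z^n - 1): on multiples of k,
    reversal preserves the powers of z^n - 1 up to units. *)
Lemma mul_rev_kuX (j : nat) :
  z ^+ (n * j) * rev (k *: (z ^+ n - 1) ^+ j)
  = ((-1) ^+ j * rev 1) * (k *: (z ^+ n - 1) ^+ j).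
Proof.
elim: j => [|j IHj]; first by rewrite muln0 !expr0 !mul1r revZ -scalerAr mulr1.
set u := z ^+ n - 1 in IHj *.
have -> : k *: u ^+ j.+1 = z ^+ n * (k *: u ^+ j) + (-1) *: (k *: u ^+ j).
  by rewrite exprS scalerAr /u mulrBl mul1r scaleN1r.
rewrite revD revZ mulnS exprD mulrAC mulrDr mul_rev_kX.
move: IHj; set r := rev _; set w := k *: _ => IHj.
have -> : z ^+ n * (-1 *: r) = - z ^+ n * r by rewrite scaleN1r mulrN mulNr.
transitivity (- u * (z ^+ (n * j) * r)); first by rewrite /u; ring.
by rewrite IHj scaleN1r exprS /u; ring.
Qed.

Lemma rev_kuX l1 (j : nat) :
  ideal2 l1 (k *: (z ^+ n - 1) ^+ j) (rev (k *: (z ^+ n - 1) ^+ j)).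
Proof.
by apply/(ideal2_XnM _ _ (n * j)); rewrite mul_rev_kuX; apply/ideal2M/ideal2_l2.
Qed.

End DefectFree.

End Reversal.

(** * The defects of the ideal *)

(** Squaring y^2 + 1 + 2 y gives y^4 + 1 + 2 y^2 up to multiples of 4, so the
    shape reproduces itself at each step. *)
Lemma expr_subr1_pow2 (A : comNzRingType) (x : A) (m : nat) : 4 = 0 :> A ->
  (x - 1) ^+ (2 ^ m.+1) = x ^+ (2 ^ m.+1) + 1 + 2 * x ^+ (2 ^ m).
Proof.
move=> A4; elim: m => [|m IHm].
  rewrite expn1 expn0 expr1.
  have -> : x ^+ 2 + 1 + 2 * x = (x - 1) ^+ 2 + 4 * x by ring.
  by rewrite A4 mul0r addr0.
have xS j : x ^+ (2 ^ j.+1) = (x ^+ (2 ^ j)) ^+ 2 by rewrite -exprM -expnSr.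
rewrite [in LHS]expnSr exprM IHm !xS; set y := x ^+ _.
have -> : (y ^+ 2 + 1 + 2 * y) ^+ 2
  = y ^+ 2 ^+ 2 + 1 + 2 * y ^+ 2 + 4 * (y ^+ 2 + y * (y ^+ 2 + 1)) by ring.
by rewrite A4 mul0r addr0.
Qed.

(** The dichotomy between the units for which substituting 1/z for z is
    legitimate and those, 3 + 3 nu and 3 + nu for theta = 0, for which rev has
    defects. *)
Lemma betas_cases (t : theta) (b : Rring t) : b \in betas t ->
  b ^+ 2 = 1 \/ [/\ kk t * kk t = 0, b ^+ 2 - 1 = 2 * kk t & kk t * b = - kk t].
Proof.
(* Identities in R_theta become identities over the integers in the letter nu
   once the multiples of 4 and of nu^2 - theta are displayed. *)
pose m := in_qpoly (R_poly t) (theta_poly t).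
have key (x y a c : Rring t) : x = y + 4 * a + c * (nu t ^+ 2 - m) -> x = y.
  by move=> ->; rewrite four_eq0 nu_sqr subrr mul0r mulr0 !addr0.
case: t b @m key => b /=.
- rewrite in_qpoly0 => key; rewrite !inE => /or4P[] /eqP ->.
  + by left; apply: (key _ _ 2 0); ring.
  + by left; apply: (key _ _ (2 + 3 * nu theta0) 4); ring.
  + right; split; first by apply: (key _ _ 0 1); ring.
      by apply: (key _ _ (2 + 4 * nu theta0) 9); ring.
    by apply: (key _ _ (nu theta0) 3); ring.
  + right; split; first by apply: (key _ _ 0 1); ring.
      by apply: (key _ _ (2 + nu theta0) 1); ring.
    by apply: (key _ _ (nu theta0) 1); ring.
- rewrite in_qpoly1 => key; rewrite !inE => /or4P[] /eqP ->; left.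
  + by apply: (key _ _ 2 0); ring.
  + by apply: (key _ _ 0 1); ring.
  + by apply: (key _ _ (1 + nu theta1) 4); ring.
  + by apply: (key _ _ (3 + 3 * nu theta1) 9); ring.
- rewrite -/(nu thetanu) => key; rewrite !inE => /eqP ->; left.
  by apply: (key _ _ (2 + 4 * nu thetanu) 4); ring.
Qed.

Section Defect.

Variables (R : comNzRingType) (N n m t1 t2 : nat) (b c k : R).
Hypotheses (N_gt0 : (0 < N)%N) (bc : b * c = 1) (R4 : 4 = 0 :> R).
Hypothesis NE : N = (n * 2 ^ m.+1)%N.
Hypotheses (kk0 : k * k = 0) (b2 : b ^+ 2 - 1 = 2 * k) (kb : k * b = - k).

Local Notation Q := {poly %/ constapoly N b}.
Local Notation z := ('qX : Q).
Local Notation u := (z ^+ n - 1).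

Lemma k_upow2 : k *: u ^+ (2 ^ m.+1) = (2 * k) *: z ^+ (n * 2 ^ m).
Proof.
have Q4 : 4 = 0 :> Q by rewrite -(scaler_nat 4 (1 : Q)) R4 scale0r.
rewrite expr_subr1_pow2 // -!exprM -NE constaqX_N // !scalerDr scalerA kb.
by rewrite scaleNr addNr add0r mulr_natl -scalerA scaler_nat scalerMnr.
Qed.

Variable h : Q.
Let l1 : Q := u ^+ t1 + k *: h.
Let l2 : Q := k *: u ^+ t2.

(** Every defect is 2 k times a coefficient of f. For t1 < 2^s the ideal contains
    2 k; for t1 >= 2^s its elements are so divisible that 2 k kills them all. *)
Lemma defect_in_ideal (f : Q) : ideal2 l1 l2 f ->
  ideal2 l1 l2 (((b ^+ 2 - 1) * f`_N.-1) *: 1).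
Proof.
rewrite b2 => -[x [y fE]]; have [lt1|le1] := ltnP t1 (2 ^ m.+1).
  (* Up to a unit, 2 k is k u^(2^s), and this is k u^(2^s - t1) l1. *)
  rewrite mulrC -scalerA; apply: ideal2Z.
  apply/(ideal2_XnM N_gt0 bc _ _ (n * 2 ^ m)).
  rewrite -scalerAr mulr1 -k_upow2 -(subnK (ltnW lt1)) exprD.
  set v := u ^+ (_ - _).
  have -> : k *: (v * u ^+ t1) = (k *: v) * l1.
    by rewrite /l1 mulrDr -!scalerAl -scalerAr scalerA kk0 scale0r addr0.
  exact/ideal2M/ideal2_l1.
have kk2 : 2 * k * k = 0 by rewrite -mulrA kk0 mulr0.
have kl1 : (2 * k) *: l1 = 0.
  rewrite /l1 scalerDr scalerA kk2 scale0r addr0.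
  have kk4 : 2 * (2 * k) = 0 by rewrite mulrA -natrM R4 mul0r.
  rewrite -(subnK le1) exprD scalerAr -scalerA k_upow2 scalerA kk4.
  by rewrite scale0r mulr0.
have kf : (2 * k) *: f = 0.
  rewrite fE scalerDr !scalerAr kl1 /l2 scalerA kk2 scale0r.
  by rewrite !mulr0 addr0.
have -> : 2 * k * f`_N.-1 = 0.
  by rewrite -coefZ -[_ *: _]/(val (_ *: f)) kf coef0.
by exists 0, 0; rewrite scale0r !mul0r addr0.
Qed.

End Defect.

Theorem theorem5p3 (t : theta) (beta : Rring t) (hbeta : beta \in betas t)
  (n s N : nat) (hn : (0 < n)%N) (hodd : odd n) (hs : (0 < s)%N)
  (hN : N = (n * 2 ^ s)%N)
  (t1 t2 : nat) (ht1 : (t1 <= 2 ^ s.+1)%N) (ht2 : (t2 <= 2 ^ s.+1)%N)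
  (h : {poly %/ ('X^N + 1 : {poly 'Z_4})})
  (l1 l2 : {poly %/ constapoly N beta})
  (hl1 : l1 = ('qX ^+ n - 1) ^+ t1
              + kk t *: in_qpoly (constapoly N beta) (lift_R t h))
  (hl2 : l2 = kk t *: ('qX ^+ n - 1) ^+ t2)
  (C : {pred 'rV[Rring t]_N})
  (hC : constacyclic beta C)
  (hgen : generated_by beta C l1 l2) :
  (constacyclic beta C /\ reversible C) <->
  poly_rV (reciprocal l1) \in C.
Proof.
have N_gt0 : (0 < N)%N by rewrite hN muln_gt0 hn expn_gt0.
have [c bc] := betas_unit hbeta.
have poly_rVK (p : {poly Rring t}) :
    (size p <= N)%N -> poly_rV p \in C <-> ideal2 l1 l2 (in_qpoly _ p).
  by move=> sp; rewrite hgen poly_rV_K.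
have recip_rev : poly_rV (reciprocal l1) \in C <-> ideal2 l1 l2 (rev l1).
  rewrite poly_rVK; last by rewrite (leq_trans (size_poly _ _)) ?size_constaq.
  rewrite -mulXn_reciprocal //; apply: iff_sym.
  exact: (ideal2_XnM N_gt0 bc).
rewrite recip_rev; split=> [[_ revC]|Irl1].
  have := revC (poly_rV l1).
  rewrite poly_rVK ?size_constaq // in_constaqK // => /(_ (ideal2_l1 _ _)).
  by rewrite hgen in_qpoly_rVpoly_rev // poly_rV_K ?size_constaq // in_constaqK.
split=> // v; rewrite !hgen in_qpoly_rVpoly_rev //.
have kdefect : kk t * (beta ^+ 2 - 1) = 0.
  have [->|[kk0 -> _]] := betas_cases hbeta; first by rewrite subrr mulr0.
  by rewrite mulrCA kk0 mulr0.
apply: (ideal_rev_closed N_gt0 bc) => //; last first.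
  by rewrite hl2; apply: (rev_kuX N_gt0 bc).
move=> f If; have [b2|[kk0 b2 kb]] := betas_cases hbeta.
  by rewrite b2 subrr mul0r; exists 0, 0; rewrite scale0r !mul0r addr0.
case: s hs hN {ht1 ht2} => // m _ NE.
move: If; rewrite hl1 hl2.
exact: (defect_in_ideal N_gt0 bc (four_eq0 t) NE kk0 b2 kb).
Qed.
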